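(* Let $n\ge 1$, $r\ge 2$, $s\ge 1$ be integers and $k=rs$. Let $G_{r,2s}(2n)$ be the graph with vertex set $\{u_i,v_i: 1\le i\le 2k\}\cup\{y_{b,j},z_{b,j}: 1\le b\le r,\ 1\le j\le 2n\}$ and edges: $u_iv_i$ for $1\le i\le 2k$; and, for each $1\le b\le r$, each $i\in\{(b-1)s+1,\dots,bs\}$ and each $1\le j\le 2n$, the edges $u_iy_{b,j}$, $v_{2k+1-i}y_{b,j}$, $v_iz_{b,j}$, $u_{2k+1-i}z_{b,j}$. Then $\chi_{la}(G_{r,2s}(2n))=3$.
   Context: For a graph $G$ with $q$ edges, a local antimagic labeling is a bijection $f:E(G)\to\{1,\dots,q\}$ such that, writing $f^+(u)=\sum_{e\ni u}f(e)$, we have $f^+(u)\ne f^+(v)$ for every edge $uv$. $\chi_{la}(G)$ is the minimum over all local antimagic labelings of the number of distinct values of $f^+$. *)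

(* Defs.v *)
From HB Require Import structures.
From mathcomp Require Import all_boot.

Set Implicit Arguments.
Unset Strict Implicit.
Unset Printing Implicit Defensive.

Record sgraph := SGraph {
  vertex : finType;
  adj : rel vertex;
  adj_sym : symmetric adj;
  adj_irr : irreflexive adj }.

Definition edges (G : sgraph) : {set {set vertex G}} :=
  [set [set x; y] | x in vertex G, y in vertex G & adj x y].

Section LocalAntimagic.
Variable G : sgraph.

Definition nb_edges := #|edges G|.

(* Labels are the nonzero elements of 'I_q.+1, q = nb_edges. The values of a
   labeling outside of edges G are arbitrary and never used. *)
Definition labeling := {ffun {set vertex G} -> 'I_nb_edges.+1}.

Definition edge_bijective (f : labeling) : bool :=
  dinjectiveb f (mem (edges G)) &&
  (f @: edges G == [set l : 'I_nb_edges.+1 | 0 < l]).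

Definition vsum (f : labeling) (x : vertex G) : nat :=
  \sum_(e in edges G | x \in e) f e.

Definition local_antimagic (f : labeling) : bool :=
  edge_bijective f &&
  [forall x, forall y, adj x y ==> (vsum f x != vsum f y)].

Definition nb_colors (f : labeling) : nat :=
  size (undup [seq vsum f x | x <- enum (vertex G)]).

(* None when G has no local antimagic labeling, e.g. when a connected
   component of G is a single edge. *)
Definition chi_la : option nat :=
  if [pick f : labeling | local_antimagic f] is Some f0 then
    Some (nb_colors [arg min_(f < f0 | local_antimagic f) nb_colors f])
  else None.

End LocalAntimagic.

(* All indices start from 0; hence the index 2k + 1 - i becomes rev_ord i. *)
Section Grsn.
Variables r s n : nat.

Definition uv_index := 'I_(2 * (r * s)).
Definition yz_index := ('I_r * 'I_(2 * n))%type.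

Inductive Gvertex :=
  | U of uv_index
  | V of uv_index
  | Y of yz_index
  | Z of yz_index.

Definition sum_of_Gvertex (x : Gvertex) :
    (uv_index + uv_index) + (yz_index + yz_index) :=
  match x with
  | U i => inl (inl i)
  | V i => inl (inr i)
  | Y p => inr (inl p)
  | Z p => inr (inr p)
  end.

Definition Gvertex_of_sum
    (x : (uv_index + uv_index) + (yz_index + yz_index)) : Gvertex :=
  match x with
  | inl (inl i) => U i
  | inl (inr i) => V i
  | inr (inl p) => Y p
  | inr (inr p) => Z p
  end.

Lemma sum_of_GvertexK : cancel sum_of_Gvertex Gvertex_of_sum.
Proof. by case. Qed.

HB.instance Definition _ := Finite.copy Gvertex (can_type sum_of_GvertexK).

Definition in_block (b : 'I_r) (i : uv_index) : bool :=
  b * s <= i < b.+1 * s.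

Definition Garc (x y : Gvertex) : bool :=
  match x, y with
  | U i, V i' => i == i'
  | U i, Y (b, j) => in_block b i
  | V i', Y (b, j) => in_block b (rev_ord i')
  | V i, Z (b, j) => in_block b i
  | U i', Z (b, j) => in_block b (rev_ord i')
  | _, _ => false
  end.

Definition Gadj : rel Gvertex := fun x y => Garc x y || Garc y x.

Lemma Gadj_sym : symmetric Gadj.
Proof. by move=> x y; rewrite /Gadj orbC. Qed.

Lemma Gadj_irr : irreflexive Gadj.
Proof. by case. Qed.

(* The graph G_{r,2s}(2n). *)
Definition Grsn : sgraph := SGraph Gadj_sym Gadj_irr.

End Grsn.

(* Main.v *)
Require Import Defs.
From mathcomp Require Import all_boot.
From mathcomp Require Import zify.

(* Lower bound: the component of a block is bipartite, and exchanging U with V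
   and Y with Z swaps its two sides, which thus have the same size. The labels
   of the component sum to the total color of either side, so with only two
   colors, one per side, these two colors would be equal.

   Upper bound: let K = 2rs and P = (4n+2)K+1, indices starting from 0. The
   edge u_i v_i gets K - i; the j-th other edge at u_i gets a label a(i,j),
   and the j-th other edge at v_{K-1-i} gets P - a(i,j), so that every y and z
   has color sP. The a(i,j) take one label from each pair {x, P - x} with
   K < x, in such a way that \sum_j a(i,j) + (K - i) does not depend on i. *)

Set Implicit Arguments.
Unset Strict Implicit.
Unset Printing Implicit Defensive.

(** * Color sums and color counts in an arbitrary graph *)

Section Graphs.
Variable G : sgraph.
Implicit Types (x y : vertex G) (f : labeling G) (A B : {set vertex G}).

Lemma edgesP (e : {set vertex G}) :
  reflect (exists x y, adj x y /\ e = [set x; y]) (e \in edges G).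
Proof.
apply: (iffP imset2P) => [[x y _]|[x [y [xy ->]]]].
  by rewrite inE => xy ->; exists x, y.
by exists x y; rewrite ?inE.
Qed.

(** Double counting: the label of an edge is counted once for each of its ends in [A]. *)
Lemma sum_vsum f A :
  \sum_(x in A) vsum f x = \sum_(e in edges G) #|e :&: A| * f e.
Proof.
rewrite /vsum (exchange_big_dep (mem (edges G))) /=; last by move=> x e _ /andP[].
apply: eq_bigr => e eE; rewrite -sum1_card big_distrl /=.
by apply: eq_big => [x|x _]; rewrite ?mul1n// inE eE andbC.
Qed.

Lemma cardI_pair x y A : x != y ->
  #|[set x; y] :&: A| = (x \in A) + (y \in A).
Proof.
move=> xy; rewrite -sum1_card (eq_bigl _ _ (fun z => in_setI z _ _)) big_mkcondr /=.
rewrite big_setU1 ?inE//= big_set1.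
by case: (x \in A); case: (y \in A).
Qed.

Lemma sum_vsum_balanced f A B :
    (forall x y, adj x y -> (x \in A) + (y \in A) = (x \in B) + (y \in B)) ->
  \sum_(x in A) vsum f x = \sum_(x in B) vsum f x.
Proof.
move=> AB; rewrite !sum_vsum; apply: eq_bigr => e /edgesP[x [y [xy ->]]].
have xNy : x != y by apply: contraTneq xy => ->; rewrite adj_irr.
by rewrite !cardI_pair// (AB _ _ xy).
Qed.

Lemma nb_colors_ge3 f x y z :
    uniq [:: vsum f x; vsum f y; vsum f z] -> 3 <= nb_colors f.
Proof.
move=> /uniq_leq_size; apply=> c; rewrite mem_undup !inE.
by case/or3P=> /eqP->; apply: map_f; rewrite mem_enum.
Qed.

Lemma nb_colors_le f (cs : seq nat) :
  (forall x, vsum f x \in cs) -> nb_colors f <= size cs.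
Proof.
move=> fcs; apply: uniq_leq_size (undup_uniq _) _ => c.
by rewrite mem_undup => /mapP[x _ ->].
Qed.

Lemma chi_laP k f :
    (forall g : labeling G, local_antimagic g -> k <= nb_colors g) ->
    local_antimagic f -> nb_colors f <= k ->
  chi_la G = Some k.
Proof.
move=> ge_k f_la f_le; rewrite /chi_la; case: pickP => [f0 f0_la|/(_ f)].
  case: arg_minnP => // g g_la g_min; congr Some; apply/eqP.
  by rewrite eqn_leq ge_k// (leq_trans (g_min _ f_la)).
by rewrite f_la.
Qed.

(** * Labelings defined on the arcs of an orientation *)

Section Orientation.
Variable arc : rel (vertex G).
Hypothesis adj_arc : forall x y, adj x y = arc x y || arc y x.
Hypothesis arc_asym : forall x y, arc x y -> ~~ arc y x.

Let arcs := [set p : vertex G * vertex G | arc p.1 p.2].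
Let ends (p : vertex G * vertex G) := [set p.1; p.2].

(** The only other ordered pair with the same ends is the reversed one, which asymmetry excludes. *)
Lemma ends_inj : {in arcs &, injective ends}.
Proof.
move=> [x y] [x' y']; rewrite !inE /ends /= => xy xy' E.
have xNy : x != y.
  by apply: contraTneq xy => ->; apply/negP=> a; move: (arc_asym a); rewrite a.
have: x \in [set x'; y'] by rewrite -E !inE eqxx.
have: y \in [set x'; y'] by rewrite -E !inE eqxx orbT.
rewrite !inE => /orP[]/eqP yE /orP[]/eqP xE; subst x y; rewrite ?eqxx// in xNy *.
by move: (arc_asym xy); rewrite xy'.
Qed.

Lemma edges_arcs : edges G = ends @: arcs.
Proof.
apply/setP=> e; apply/edgesP/imsetP => [[x [y [xy ->]]]|[[x y]]].
  move: xy; rewrite adj_arc => /orP[] xy; first by exists (x, y); rewrite ?inE.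
  by exists (y, x); rewrite ?inE // /ends setUC.
by rewrite inE /= => xy ->; exists x, y; rewrite adj_arc xy.
Qed.

Lemma nb_edges_arcs : nb_edges G = #|arcs|.
Proof. by rewrite /nb_edges edges_arcs card_in_imset //; exact: ends_inj. Qed.

Lemma vsum_arcs f x :
  vsum f x = \sum_(y | arc x y) f [set x; y] + \sum_(y | arc y x) f [set y; x].
Proof.
rewrite /vsum edges_arcs big_imset_cond; last exact: ends_inj.
transitivity (\sum_a \sum_(b | arc a b && ((x == a) || (x == b)))
                nat_of_ord (f [set a; b])).
  by rewrite pair_big_dep; apply: eq_bigl => p; rewrite !inE.
rewrite (bigD1 x) //=; congr (_ + _).
  by apply: eq_bigl => y; rewrite eqxx andbT.
(* The term at [x] of the incoming sum vanishes, as asymmetry forbids loops. Any other tail [y]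
   contributes only through the head [x]. *)
rewrite [RHS]big_mkcond [RHS](bigD1 x) //= ifN ?add0n.
  apply: eq_bigr => y yx; rewrite (eq_bigl (fun b => (b == x) && arc y x)).
    by rewrite big_andbC; case: ifP => _; rewrite ?big_pred1_eq ?big_pred0_eq.
  move=> b; rewrite [x == y]eq_sym (negPf yx) /= eq_sym.
  by case: eqP => [->|_]; rewrite ?andbF ?andbT.
by apply/negP=> a; move: (arc_asym a); rewrite a.
Qed.

Variable lab : vertex G -> vertex G -> nat.
Hypothesis lab_range : forall x y, arc x y -> 0 < lab x y <= nb_edges G.
Hypothesis lab_inj : forall x y x' y', arc x y -> arc x' y' ->
  lab x y = lab x' y' -> (x, y) = (x', y').

(** The sum serves to select an arc: by [ends_inj] it has a single term when [e] is an edge, and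
    [lab_range] keeps this term in the range where [inord] is faithful. *)
Definition arc_labeling : labeling G :=
  [ffun e => inord (\sum_(p in arcs | ends p == e) lab p.1 p.2)].

Lemma arc_labelingE x y :
  arc x y -> arc_labeling [set x; y] = lab x y :> nat.
Proof.
move=> xy; have xyA : (x, y) \in arcs by rewrite inE.
rewrite ffunE (eq_bigl (pred1 (x, y))) ?big_pred1_eq.
  by rewrite inordK // ltnS; case/andP: (lab_range xy).
move=> p /=; apply/andP/eqP => [[pA /eqP]|->]; last by [].
exact: (ends_inj pA xyA).
Qed.

Lemma arc_labeling_bij : edge_bijective arc_labeling.
Proof.
have inj : {in edges G &, injective arc_labeling}.
  rewrite edges_arcs => _ _ /imsetP[[x y] xy ->] /imsetP[[x' y'] xy' ->].
  rewrite !inE /= in xy xy' => /(congr1 (@nat_of_ord _)).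
  by rewrite /ends /= !arc_labelingE// => /(lab_inj xy xy')[-> ->].
apply/andP; split; first exact/dinjectiveP.
(* By injectivity the image has as many elements as there are nonzero labels, so one inclusion
   suffices. *)
rewrite eqEcard (card_in_imset inj); apply/andP; split.
  apply/subsetP=> _ /imsetP[e + ->]; rewrite edges_arcs => /imsetP[[x y]].
  by rewrite !inE /= => xy ->; rewrite arc_labelingE//; case/andP: (lab_range xy).
rewrite (_ : [set _ | _] = ~: [set ord0]) ?cardsC1 ?card_ord//.
by apply/setP=> l; rewrite !inE lt0n.
Qed.

End Orientation.
End Graphs.

(** * Arithmetic of the labels and of the three colors *)

Section Spokes.
Variables K n : nat.

(* For a fixed j, spoke i j is an arithmetic progression in i, of step 2 if
   j = 0, -1 if j is odd and 1 otherwise; with the step -1 of the label K - i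
   of u_i v_i, the steps add up to 0. The progression of step 2 is centered so
   that it and its image by x |-> P - x cover the two parities of the same
   interval. *)
Definition spoke (i j : nat) : nat :=
  if j == 0 then 2 * n * K + 2 * i + 1
  else if odd j then 2 * n * K + (j + 2) * K - i
  else 2 * n * K + (j + 1) * K + 1 + i.

Definition pair_total : nat := (4 * n + 2) * K + 1.

Lemma spoke0 i : spoke i 0 = 2 * n * K + 2 * i + 1.
Proof. by []. Qed.

(** Whatever its direction, each progression with [0 < j] fills its own interval of [K] labels.
    These intervals are consecutive and lie above the progression [j = 0], which separates distinct
    values of [j]. *)
Lemma spoke_pos i j : i < K -> 0 < j ->
  2 * n * K + (j + 1) * K < spoke i j <= 2 * n * K + (j + 2) * K.
Proof. by move=> iK; rewrite /spoke; case: j => // j _ /=; case: odd => /=; nia. Qed.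

Lemma spoke_bounds i j : i < K -> j < 2 * n ->
  K < spoke i j <= (4 * n + 1) * K.
Proof.
move=> iK; case: j => [|j] jn; first by rewrite spoke0; nia.
have /andP[l u] := spoke_pos iK (ltn0Sn j).
have : (j.+1 + 2) * K <= (2 * n + 1) * K by rewrite leq_mul2r; lia.
by nia.
Qed.

Lemma spoke_le_total i j : i < K -> j < 2 * n -> spoke i j <= pair_total.
Proof. by move=> iK jn; have := spoke_bounds iK jn; rewrite /pair_total; nia. Qed.

Lemma spoke_lt i j i' j' : i < K -> i' < K -> 0 < j -> j' < j ->
  spoke i' j' < spoke i j.
Proof.
move=> iK iK' j0 jj'; have /andP[l _] := spoke_pos iK j0.
apply: leq_ltn_trans l; case: j' jj' => [|j'] jj'; first by rewrite spoke0; nia.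
have /andP[_ u] := spoke_pos iK' (ltn0Sn j').
by apply: (leq_trans u); rewrite leq_add2l leq_mul2r; lia.
Qed.

Lemma spoke_inj i j i' j' : i < K -> i' < K ->
  spoke i j = spoke i' j' -> i = i' /\ j = j'.
Proof.
move=> iK iK'; case: (ltngtP j j') => [jj'|jj'|<-] E.
- by have := @spoke_lt i' j' i j iK' iK (leq_ltn_trans (leq0n _) jj') jj'; rewrite E ltnn.
- by have := @spoke_lt i j i' j' iK iK' (leq_ltn_trans (leq0n _) jj') jj'; rewrite E ltnn.
split=> //; move: E; rewrite /spoke; case: j => [|j] /=; first by lia.
by case: odd => /=; nia.
Qed.

(** If [j] or [j'] is positive, the sum exceeds [pair_total]. If both are 0, the two labels are odd,
    so their sum is even, whereas [pair_total] is odd. *)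
Lemma spoke_add_neq i j i' j' : i < K -> i' < K ->
  spoke i j + spoke i' j' != pair_total.
Proof.
move=> iK iK'; apply/eqP; rewrite /pair_total.
have lb m l : m < K -> 2 * n * K < spoke m l.
  by case: l => [|l] mK; [rewrite spoke0; lia | have := spoke_pos mK (ltn0Sn l); nia].
have lb' m l : m < K -> 0 < l -> 2 * n * K + 2 * K < spoke m l.
  by move=> mK l0; have := spoke_pos mK l0; nia.
case: (posnP j) => [->|j0]; last by have := lb' _ _ iK j0; have := lb i' j' iK'; nia.
case: (posnP j') => [->|j0]; last by have := lb' _ _ iK' j0; have := lb i 0 iK; nia.
by rewrite !spoke0; nia.
Qed.

(** The bound [m] is kept apart from the [n] inside [spoke] to allow induction. The base case has
    steps 2 and -1, and -1 from [K - i]; each further pair of values of [j] has steps 1 and -1, so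
    [i] always cancels. *)
Lemma sum_spoke_base i m : i < K -> 0 < m ->
  \sum_(j < 2 * m) spoke i j + (K - i) =
  m * (4 * n * K + 1) + 2 * K * (m * (m + 1)).
Proof.
move=> iK; case: m => // m _; elim: m => [|m IHm].
  by rewrite !big_ord_recr big_ord0 /spoke /=; nia.
have -> : 2 * m.+2 = (2 * m.+1).+2 by lia.
have -> : \sum_(j < (2 * m.+1).+2) spoke i j =
    \sum_(j < 2 * m.+1) spoke i j + spoke i (2 * m.+1) + spoke i (2 * m.+1).+1.
  by rewrite 2!big_ord_recr.
have -> : spoke i (2 * m.+1) = 2 * n * K + (2 * m.+1 + 1) * K + 1 + i.
  by rewrite /spoke !ifN //; lia.
have -> : spoke i (2 * m.+1).+1 = 2 * n * K + ((2 * m.+1).+1 + 2) * K - i.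
  by rewrite /spoke; have -> : odd (2 * m.+1).+1 by lia.
set S := \sum_(_ < _) _ in IHm *; nia.
Qed.

Definition u_color : nat := n * pair_total + 2 * K * n ^ 2.
(** The spokes at v_{K-1-i} are the complements of those at u_i, and the labels [K - i] and [i + 1]
    of the edges u_i v_i and u_{K-1-i} v_{K-1-i} add up to [K + 1]. The subtraction is exact by
    [u_color_le]. *)
Definition v_color : nat := 2 * n * pair_total + (K + 1) - u_color.

Lemma sum_spoke i : i < K -> 0 < n ->
  \sum_(j < 2 * n) spoke i j + (K - i) = u_color.
Proof.
by move=> iK n0; rewrite sum_spoke_base// /u_color /pair_total; nia.
Qed.

Lemma u_color_le : u_color <= 2 * n * pair_total.
Proof. by rewrite /u_color /pair_total; nia. Qed.

(** Equality would give [2 * u_color = 2 * n * pair_total + (K + 1)], whose right side is odd. *)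
Lemma u_color_neq_v_color : ~~ odd K -> u_color != v_color.
Proof. by move=> Ke; apply/eqP; rewrite /v_color /u_color /pair_total; nia. Qed.

(* An equality of colors gives K | t - n, but 0 < t - n < K. *)
Lemma u_color_neq_hub t : 0 < n -> t < K -> u_color != t * pair_total.
Proof.
move=> n0 tK; apply/eqP; rewrite /u_color => E.
have nt : n < t by rewrite ltnNge; apply/negP => tn; rewrite /pair_total in E; nia.
have [d tE] : exists d, t = n + d by exists (t - n); lia.
have d0 : 0 < d by lia.
have {E} E : 2 * K * n ^ 2 = d * pair_total by move: E; rewrite tE; nia.
have E' : d + K * (d * (4 * n + 2)) = K * (2 * n ^ 2).
  by move: E; rewrite /pair_total; nia.
have : d * (4 * n + 2) < 2 * n ^ 2 by rewrite -(@ltn_pmul2l K); lia.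
by nia.
Qed.

(* Here an equality of colors gives n - t = K e - 1 with
   e = 2 n^2 - (n - t)(4 n + 2) - 1 > 0, so t <= n - t and thus e < 0. *)
Lemma v_color_neq_hub t : 0 < n -> 0 < t -> t < K -> v_color != t * pair_total.
Proof.
move=> n0 t0 tK; apply/eqP; rewrite /v_color => E.
have {E} E : t * pair_total + 2 * K * n ^ 2 = n * pair_total + (K + 1).
  have := u_color_le; rewrite /u_color in E *; nia.
have tn : t < n.
  rewrite ltnNge; apply/negP => nt.
  have : n * pair_total <= t * pair_total by rewrite leq_mul2r nt orbT.
  by nia.
have [d nE] : exists d, n = t + d by exists (n - t); lia.
have {E} E : 2 * K * n ^ 2 = d * pair_total + (K + 1) by move: E; rewrite {2}nE; nia.
have E' : d + 1 + K * (d * (4 * n + 2) + 1) = K * (2 * n ^ 2).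
  by move: E; rewrite /pair_total; nia.
have lt : d * (4 * n + 2) + 1 < 2 * n ^ 2 by rewrite -(@ltn_pmul2l K); lia.
have [e eE] : exists e, 2 * n ^ 2 = d * (4 * n + 2) + 1 + e.
  by exists (2 * n ^ 2 - (d * (4 * n + 2) + 1)); lia.
have dE : d + 1 = K * e by nia.
have e0 : 0 < e by lia.
have Kd : K <= d + 1 by rewrite dE leq_pmulr.
have td : t <= d by lia.
have := leq_mul td td; move: eE; rewrite nE; clear; lia.
Qed.
End Spokes.

(** * Blocks of indices and sums over the vertices of the graph *)

Section Grsn.
Variables r s n : nat.
Hypotheses (hn : 0 < n) (hr : 1 < r) (hs : 0 < s).
Local Notation K := (2 * (r * s)).
Local Notation vtx := (Gvertex r s n).
Local Notation G := (Grsn r s n).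
Implicit Types (b : 'I_r) (i : uv_index r s) (j : 'I_(2 * n)).

Lemma in_block_val b i : in_block b i = (b == i %/ s :> nat).
Proof.
rewrite /in_block eqn_leq leq_divRL// -[i %/ s <= b]ltnS ltn_divLR//.
Qed.

Lemma in_block_eq b b' i : in_block b i -> in_block b' i = (b' == b).
Proof. by rewrite !in_block_val => /eqP <-. Qed.

Lemma in_block_lt b i : in_block b i -> i < r * s.
Proof.
case/andP=> _ /leq_trans; apply; rewrite leq_mul2r; apply/orP; right.
exact: ltn_ord.
Qed.

(** Blocks cover the first half of the indices, which [rev_ord] sends to the second half. *)
Lemma in_block_rev b b' i : in_block b i -> in_block b' (rev_ord i) = false.
Proof.
move=> /in_block_lt ilt; apply/negP => /in_block_lt /=; lia.
Qed.

Lemma count_block_lt i : i < r * s -> \sum_(b | in_block b i) 1 = 1.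
Proof.
move=> ilt; have blt : i %/ s < r by rewrite ltn_divLR.
rewrite (eq_bigl (pred1 (Ordinal blt))) ?big_pred1_eq// => b.
by rewrite in_block_val.
Qed.

(** Exactly one of [i] and [rev_ord i] is in the first half, and it lies in a single block. Hence
    each u or v is joined to the hubs of one block and of one kind, [Y] or [Z]. *)
Lemma count_block i :
  \sum_(b | in_block b i) 1 + \sum_(b | in_block b (rev_ord i)) 1 = 1.
Proof.
have no (k : uv_index r s) : r * s <= k -> \sum_(b | in_block b k) 1 = 0.
  by move=> kge; rewrite big_pred0// => b; apply/negP => /in_block_lt; lia.
have [ilt|ige] := ltnP i (r * s).
  by rewrite count_block_lt// no//=; lia.
by rewrite no// count_block_lt//=; have := ltn_ord i; lia.
Qed.

Lemma big_Gvertex (P : pred vtx) (F : vtx -> nat) :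
  \sum_(x | P x) F x =
    (\sum_(i | P (U n i)) F (U n i) + \sum_(i | P (V n i)) F (V n i)) +
    (\sum_(p | P (Y s p)) F (Y s p) + \sum_(p | P (Z s p)) F (Z s p)).
Proof.
rewrite (reindex (@Gvertex_of_sum r s n)).
  by rewrite !big_sumType.
exists (@sum_of_Gvertex r s n) => x _; last exact: sum_of_GvertexK.
by case: x => [[]|[]].
Qed.

(** Adjacency to the hub [(b, j)] depends only on [b], and the label only on [j]. The first factor
    is then evaluated by [count_block]. *)
Lemma big_hub (P : pred 'I_r) (F : 'I_(2 * n) -> nat) (Q : pred (yz_index r n))
    (H : yz_index r n -> nat) :
    (forall b j, Q (b, j) = P b) -> (forall b j, H (b, j) = F j) ->
  \sum_(p | Q p) H p = (\sum_(b | P b) 1) * \sum_j F j.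
Proof.
move=> QP HF; rewrite big_distrl /= (eq_bigr (fun b => \sum_j F j)).
  by rewrite pair_big_dep; apply: eq_big => [[b j]|[b j] _]; rewrite ?QP ?HF ?andbT.
by move=> b _; rewrite mul1n.
Qed.

(** * The labeling with three colors *)

Definition arc_label (x y : vtx) : nat :=
  match x, y with
  | U i, V _ => K - i
  | U i, Y (_, j) => spoke K n i j
  | U i, Z (_, j) => spoke K n i j
  | V i, Y (_, j) => pair_total K n - spoke K n (rev_ord i) j
  | V i, Z (_, j) => pair_total K n - spoke K n (rev_ord i) j
  | _, _ => 0
  end.

Lemma adj_Garc (x y : vertex G) : adj x y = Garc x y || Garc y x.
Proof. by []. Qed.

Lemma Garc_asym (x y : vertex G) : Garc x y -> ~~ Garc y x.
Proof. by case: x => [i|i|[b j]|[b j]]; case: y => [i'|i'|[b' j']|[b' j']]. Qed.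

(** Arcs leave only u and v: each [i] accounts for the arc u_i v_i and, by [count_block], for
    [2 * n] arcs to hubs from each of u_i and v_i. *)
Lemma nb_edges_Grsn : nb_edges G = (4 * n + 1) * K.
Proof.
rewrite (nb_edges_arcs adj_Garc Garc_asym) -sum1_card.
transitivity (\sum_(x : vtx) \sum_(y | Garc x y) 1).
  by rewrite pair_big_dep; apply: eq_bigl => p; rewrite inE.
have hub P : \sum_(p : yz_index r n | (let (b, _) := p in P b)) 1 =
    (\sum_(b | P b) 1) * (2 * n).
  by rewrite (big_hub (P := P) (F := fun=> 1)) // [X in _ * X]sum1_card card_ord.
rewrite big_Gvertex; under eq_bigr do rewrite big_Gvertex /=.
under [X in _ + X + _]eq_bigr do rewrite big_Gvertex /=.
rewrite [X in _ + (X + _)]big1 ?[X in _ + (_ + X)]big1; last first.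
- by move=> [b j] _; rewrite big_Gvertex /= !big_pred0_eq.
- by move=> [b j] _; rewrite big_Gvertex /= !big_pred0_eq.
rewrite !addn0 -big_split /= (eq_bigr (fun=> 4 * n + 1)); last first.
  move=> i _; rewrite !big_pred0_eq !hub (big_pred1 i); last by move=> ?; rewrite eq_sym.
  by have := count_block i; nia.
by rewrite sum_nat_const card_ord mulnC.
Qed.

Lemma arc_label_range (x y : vertex G) :
  Garc x y -> 0 < arc_label x y <= nb_edges G.
Proof.
rewrite nb_edges_Grsn.
have Sb i j := spoke_bounds (ltn_ord i) (ltn_ord j).
case: x => [i|i|[b j]|[b j]]; case: y => [i'|i'|[b' j']|[b' j']] //= _.
- by have := ltn_ord i; nia.
- by have := Sb i j'; nia.
- by have := Sb i j'; nia.
- by have := Sb (rev_ord i) j'; rewrite /= /pair_total; nia.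
- by have := Sb (rev_ord i) j'; rewrite /= /pair_total; nia.
Qed.


(** Labels up to [K] belong to the edges u_i v_i. Above [K], spokes and complements are disjoint by
    [spoke_add_neq], and either kind determines [i] and [j]; then [i] determines the block and the
    kind of hub. *)
Lemma arc_label_inj (x y x' y' : vertex G) : Garc x y -> Garc x' y' ->
  arc_label x y = arc_label x' y' -> (x, y) = (x', y').
Proof.
have Sb i j := spoke_bounds (ltn_ord i) (ltn_ord j).
have Sle i j := spoke_le_total (ltn_ord i) (ltn_ord j).
have Sinj i j i' j' : spoke K n i j = spoke K n i' j' -> i = i' /\ j = j'.
  by case/(spoke_inj (ltn_ord i) (ltn_ord i')) => /val_inj -> /val_inj ->.
have Sinj' i j i' j' : pair_total K n - spoke K n (rev_ord i) j =
    pair_total K n - spoke K n (rev_ord i') j' -> i = i' /\ j = j'.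
  move=> E; have [] : rev_ord i = rev_ord i' /\ j = j'.
    by apply: Sinj; have := Sle (rev_ord i) j; have := Sle (rev_ord i') j'; lia.
  by move=> /rev_ord_inj.
have Sneq i j i' j' : spoke K n i j <> pair_total K n - spoke K n (rev_ord i') j'.
  move=> E; have /eqP := spoke_add_neq n j j' (ltn_ord i) (ltn_ord (rev_ord i')).
  by apply; rewrite E subnK// Sle.
have Mneq i i' j : K - i <> spoke K n i' j by have := Sb i' j; lia.
have Mneq' i i' j : K - i <> pair_total K n - spoke K n (rev_ord i') j.
  by have := Sb (rev_ord i') j; rewrite /pair_total; lia.
have noY i b b' : in_block b i -> in_block b' (rev_ord i) -> False.
  by move=> h; rewrite (in_block_rev _ h).
have same i b b' : in_block b i -> in_block b' i -> b = b'.
  by move=> h; rewrite (in_block_eq _ h) => /eqP.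
case: x => [i|i|[b j]|[b j]]; case: y => [k|k|[c l]|[c l]] //= a;
case: x' => [i'|i'|[b' j']|[b' j']]; case: y' => [k'|k'|[c' l']|[c' l']] //= a' E;
try (by case: (Mneq _ _ _ E)); try (by case: (Mneq _ _ _ (esym E)));
try (by case: (Mneq' _ _ _ E)); try (by case: (Mneq' _ _ _ (esym E)));
try (by case: (Sneq _ _ _ _ E)); try (by case: (Sneq _ _ _ _ (esym E)));
try (case/Sinj: E => ? ?; subst); try (case/Sinj': E => ? ?; subst);
try (by case: (noY _ _ _ a a')); try (by case: (noY _ _ _ a' a));
try (by rewrite (same _ _ _ a a')).
(* The case left compares two edges u_i v_i, where [i < K] makes [K - i] injective. *)
have ii : i = i'.
  by apply: val_inj; have := ltn_ord i; have := ltn_ord i'; move: E => /=; lia.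
by move: a a' => /eqP <- /eqP <-; rewrite ii.
Qed.

Definition Grsn_labeling : labeling G :=
  @arc_labeling G (@Garc r s n) arc_label.

Lemma vsum_Grsn_labeling (x : vertex G) :
  vsum Grsn_labeling x =
    \sum_(y | Garc x y) arc_label x y + \sum_(y | Garc y x) arc_label y x.
Proof.
rewrite (vsum_arcs adj_Garc Garc_asym); congr (_ + _); apply: eq_bigr => y xy;
by rewrite (arc_labelingE Garc_asym arc_label_range).
Qed.

Lemma vsum_U i : vsum Grsn_labeling (U n i) = u_color K n.
Proof.
rewrite vsum_Grsn_labeling !big_Gvertex /= !big_pred0_eq !addn0 add0n.
rewrite (big_pred1 i) => [|k]; last by rewrite /= eq_sym.
rewrite (big_hub (P := fun b => in_block b i) (F := spoke K n i))//.
rewrite (big_hub (P := fun b => in_block b (rev_ord i)) (F := spoke K n i))//.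
by rewrite -mulnDl count_block mul1n addnC sum_spoke.
Qed.

Lemma vsum_V i : vsum Grsn_labeling (V n i) = v_color K n.
Proof.
pose F j := pair_total K n - spoke K n (rev_ord i) j.
rewrite vsum_Grsn_labeling !big_Gvertex /= !big_pred0_eq !addn0 add0n.
rewrite (big_pred1 i) => [|k]; last by [].
rewrite (big_hub (P := fun b => in_block b (rev_ord i)) (F := F))//.
rewrite (big_hub (P := fun b => in_block b i) (F := F))//.
rewrite -mulnDl [X in X * _]addnC count_block mul1n.
rewrite /v_color -(sum_spoke (ltn_ord (rev_ord i)) hn).
have <- : \sum_(j < 2 * n) pair_total K n = 2 * n * pair_total K n.
  by rewrite sum_nat_const card_ord.
rewrite /F sumnB; last by move=> j _; rewrite spoke_le_total.
have : \sum_(j < 2 * n) spoke K n (rev_ord i) j <= \sum_(j < 2 * n) pair_total K n.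
  by apply: leq_sum => j _; rewrite spoke_le_total.
have := ltn_ord i.
by move=> /=; lia.
Qed.

Lemma sum_block b : \sum_(i : uv_index r s | in_block b i) 1 = s.
Proof.
have bK : b.+1 * s <= K.
  by have : b.+1 * s <= r * s; [rewrite leq_mul2r ltn_ord orbT | lia].
rewrite -(big_mkord (fun k => b * s <= k < b.+1 * s) (fun=> 1)).
under eq_bigl do rewrite andbC.
rewrite -(big_nat_widenl _ _ _ (fun k => k < b.+1 * s))//.
by rewrite -(big_nat_widen _ _ _ predT)// sum_nat_const_nat muln1 mulSn addnK.
Qed.

Lemma vsum_Y b j : vsum Grsn_labeling (Y s (b, j)) = s * pair_total K n.
Proof.
rewrite vsum_Grsn_labeling !big_Gvertex /= !big_pred0_eq !addn0 add0n.
(* After this reversal both sums run over the block [b], and the labels from u_i and v_{K-1-i} add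
   up to [pair_total]. *)
rewrite [X in _ + X](reindex_inj rev_ord_inj).
under [X in _ + X]eq_bigl do rewrite rev_ordK.
rewrite -big_split /= -[X in _ = X * _](sum_block b) big_distrl /=.
apply: eq_bigr => i _.
have -> : K - (K - i.+1).+1 = i by have := ltn_ord i; lia.
by rewrite mul1n subnKC// spoke_le_total.
Qed.

Lemma vsum_Z b j : vsum Grsn_labeling (Z s (b, j)) = s * pair_total K n.
Proof.
rewrite vsum_Grsn_labeling !big_Gvertex /= !big_pred0_eq !addn0 add0n.
rewrite [X in X + _](reindex_inj rev_ord_inj).
under [X in X + _]eq_bigl do rewrite rev_ordK.
rewrite -big_split /= -[X in _ = X * _](sum_block b) big_distrl /=.
apply: eq_bigr => i _.
by rewrite mul1n subnKC// (spoke_le_total (ltn_ord (rev_ord i))).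
Qed.

Lemma Grsn_labeling_la : local_antimagic Grsn_labeling.
Proof.
apply/andP; split.
  exact: (arc_labeling_bij adj_Garc Garc_asym arc_label_range arc_label_inj).
have sK : s < K by nia.
have uh := u_color_neq_hub hn sK.
have vh := v_color_neq_hub hn hs sK.
have uv : u_color K n != v_color K n by apply: u_color_neq_v_color; lia.
have neq (x y : vertex G) : Garc x y -> vsum Grsn_labeling x != vsum Grsn_labeling y.
  case: x => [i|i|[b j]|[b j]]; case: y => [k|k|[c l]|[c l]] //= _;
    by rewrite ?vsum_U ?vsum_V ?vsum_Y ?vsum_Z.
apply/forallP=> x; apply/forallP=> y; apply/implyP.
by rewrite adj_Garc => /orP[] /neq//; rewrite eq_sym.
Qed.

Lemma nb_colors_Grsn_labeling : nb_colors Grsn_labeling <= 3.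
Proof.
apply: (@nb_colors_le _ _ [:: u_color K n; v_color K n; s * pair_total K n]).
by case=> [i|i|[b j]|[b j]]; rewrite ?vsum_U ?vsum_V ?vsum_Y ?vsum_Z !inE eqxx ?orbT.
Qed.

(** * The lower bound, by exchanging the sides of a component *)

Definition swap_sides (x : vtx) : vtx :=
  match x with
  | U i => V n i | V i => U n i | Y p => Z s p | Z p => Y s p
  end.

Lemma swap_sidesK : involutive swap_sides.
Proof. by case. Qed.

(** One side of the bipartite component of block [b]: its [Y] hubs and the neighbors of its [Z]
    hubs. The other side is the image by [swap_sides]. *)
Definition left_side b (x : vtx) : bool :=
  match x with
  | U i => in_block b (rev_ord i) | V i => in_block b i
  | Y (c, _) => c == b | Z _ => false
  end.

(** An edge of the component has one end on each side; any other edge has none on either. *)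
Lemma left_side_balanced b (x y : vertex G) : adj x y ->
  left_side b x + left_side b y =
  left_side b (swap_sides x) + left_side b (swap_sides y).
Proof.
have arcE (z t : vertex G) : Garc z t ->
    left_side b z + left_side b t =
    left_side b (swap_sides z) + left_side b (swap_sides t).
  case: z => [i|i|[c j]|[c j]]; case: t => [k|k|[d l]|[d l]] //=.
  - by move=> /eqP ->; rewrite addnC.
  - by move=> a; rewrite (in_block_eq _ a) (in_block_rev _ a) eq_sym addnC.
  - move=> a; rewrite (in_block_eq _ a); have := in_block_rev b a.
    by rewrite rev_ordK => ->; rewrite eq_sym addnC.
  - move=> a; rewrite (in_block_eq _ a); have := in_block_rev b a.
    by rewrite rev_ordK => ->; rewrite eq_sym addnC.
  - by move=> a; rewrite (in_block_eq _ a) (in_block_rev _ a) eq_sym addnC.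
rewrite adj_Garc => /orP[] /arcE //; by rewrite addnC => ->; rewrite addnC.
Qed.

Lemma nb_colors_Grsn_ge3 (f : labeling G) : local_antimagic f -> 3 <= nb_colors f.
Proof.
case/andP=> _ /forallP f_la; rewrite leqNgt; apply/negP => f_lt3.
have neq (x y : vertex G) : adj x y -> vsum f x != vsum f y.
  by move=> xy; have /forallP/(_ y)/implyP/(_ xy) := f_la x.
have K0 : 0 < K by nia.
pose b : 'I_r := Ordinal (ltnW hr).
pose i : uv_index r s := Ordinal K0.
have ib : in_block b i by rewrite /in_block /=; lia.
set a := vsum f (U n i : vertex G); set c := vsum f (V n i : vertex G).
have ac : a != c by apply: neq; rewrite adj_Garc /= ?eqxx.
have two (x : vertex G) : (vsum f x == a) || (vsum f x == c).
  apply: contraLR f_lt3 => /norP[xa xc]; rewrite -leqNgt.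
  apply: (@nb_colors_ge3 _ f x (U n i) (V n i)).
  by rewrite /= !inE negb_or -/a -/c xa ac xc.
have other (x y : vertex G) : adj x y ->
    (vsum f x == a -> vsum f y = c) /\ (vsum f x == c -> vsum f y = a).
  move=> /neq xy.
  by split=> /eqP xE; move: xy (two y); rewrite xE eq_sym;
    [move/negPf-> => /eqP | move/negPf->; rewrite orbF => /eqP].
have n0 : 0 < 2 * n by lia.
have fY j : vsum f (Y s (b, j) : vertex G) = c.
  by apply: (other (U n i) (Y s (b, j)) _).1; rewrite ?eqxx// adj_Garc /= ib.
have fZ j : vsum f (Z s (b, j) : vertex G) = a.
  by apply: (other (V n i) (Z s (b, j)) _).2; rewrite ?eqxx// adj_Garc /= ib.
pose j0 : 'I_(2 * n) := Ordinal n0.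
(* Every u or v on this side is adjacent to the hub [Z s (b, j0)], of color [a]. *)
have left (x : vertex G) : left_side b x -> vsum f x = c.
  case: x => [k|k|[d l]|[d l]] //= a'; last by rewrite (eqP a').
  - by apply: (other (Z s (b, j0)) _ _).1; rewrite ?fZ// adj_Garc /= a' ?orbT.
  - by apply: (other (Z s (b, j0)) _ _).1; rewrite ?fZ// adj_Garc /= a' ?orbT.
have right (x : vertex G) : left_side b (swap_sides x) -> vsum f x = a.
  case: x => [k|k|[d l]|[d l]] //= a'; last by rewrite (eqP a').
  - by apply: (other (Y s (b, j0)) _ _).2; rewrite ?fY// adj_Garc /= a' ?orbT.
  - by apply: (other (Y s (b, j0)) _ _).2; rewrite ?fY// adj_Garc /= a' ?orbT.
pose A : {set vertex G} := [set x | left_side b x].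
pose B : {set vertex G} := [set x | left_side b (swap_sides x)].
have AB : #|B| = #|A|.
  rewrite -[RHS](card_preimset _ (inv_inj swap_sidesK)).
  by apply: eq_card => x; rewrite !inE.
have := @sum_vsum_balanced G f A B.
rewrite (eq_bigr (fun=> c)) => [|x]; last by rewrite inE => /left.
rewrite [X in _ = X](eq_bigr (fun=> a)) => [|x]; last by rewrite inE => /right.
rewrite !sum_nat_const AB => E.
have A0 : 0 < #|A| by apply/card_gt0P; exists (V n i); rewrite inE.
have {}E : #|A| * c = #|A| * a.
  by apply: E => x y xy; rewrite !inE; exact: left_side_balanced.
by move/eqP: E; rewrite eqn_pmul2l// eq_sym (negPf ac).
Qed.

End Grsn.

Theorem theorem2p5 (n r s : nat) (hn : 1 <= n) (hr : 2 <= r) (hs : 1 <= s) :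
  chi_la (Grsn r s n) = Some 3.
Proof.
apply: (chi_laP (f := Grsn_labeling r s n)).
- exact: nb_colors_Grsn_ge3.
- exact: Grsn_labeling_la.
- exact: nb_colors_Grsn_labeling.
Qed.
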